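(* Let $n=2m$ with $m\ge 1$, and let $F:\mathbb{F}_{2^n}\to\mathbb{F}_{2^n}$ be a plateaued vectorial function with exactly $2^n-2^m$ bent component functions (the maximal possible number). Then the nonlinearity of $F$ satisfies $$\mathcal{N}_F\le 2^{n-1}-2^{\lfloor (n+m)/2\rfloor}.$$
   Context: $\mathrm{Tr}_n$ denotes the absolute trace $\mathbb{F}_{2^n}\to\mathbb{F}_2$. For a Boolean function $f:\mathbb{F}_{2^n}\to\mathbb{F}_2$, $\mathcal{W}_f(u)=\sum_{x\in\mathbb{F}_{2^n}}(-1)^{f(x)+\mathrm{Tr}_n(ux)}$. The function $f$ is $s$-plateaued if $\mathcal{W}_f(u)\in\{0,\pm 2^{(n+s)/2}\}$ for all $u$ (with $s$ a fixed integer, $s\equiv n \bmod 2$), plateaued if it is $s$-plateaued for some $s$, and bent if $\mathcal{W}_f(u)\in\{\pm 2^{n/2}\}$ for all $u$. For $F:\mathbb{F}_{2^n}\to\mathbb{F}_{2^n}$ the component functions are $F_v(x)=\mathrm{Tr}_n(vF(x))$, $v\in\mathbb{F}_{2^n}^*$. $F$ is plateaued if every $F_v$, $v\neq 0$, is plateaued (possibly with different $s$). The nonlinearity is $\mathcal{N}_F=2^{n-1}-\frac12\max_{u\in\mathbb{F}_{2^n},\,v\in\mathbb{F}_{2^n}^*}|\mathcal{W}_{F_v}(u)|$. It is known that a function on $\mathbb{F}_{2^n}$, $n=2m$, has at most $2^n-2^m$ bent components. *)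

(* Defs.v *)
From HB Require Import structures.
From mathcomp Require Import all_boot all_order all_algebra all_field.

Set Implicit Arguments.
Unset Strict Implicit.
Unset Printing Implicit Defensive.

Import Order.TTheory GRing.Theory Num.Theory.
Local Open Scope ring_scope.

(* Throughout, K is a finite field meant to have 2 ^ n elements; the degree n
   is an explicit argument of the definitions. *)

Definition trace_sum (K : finFieldType) (n : nat) (x : K) : K :=
  \sum_(i < n) x ^+ (2 ^ i).

(* The trace lies in the prime subfield {0, 1} of K, which is identified here
   with 'F_2; see absTrE. *)
Definition absTr (K : finFieldType) (n : nat) (x : K) : 'F_2 :=
  if trace_sum n x == 0 then 0 else 1.

Lemma absTrE (K : finFieldType) (n : nat) (x : K) :
  #|K| = (2 ^ n)%N -> (absTr n x : nat)%:R = trace_sum n x.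
Proof.
move=> hK.
have ch2 : 2 \in [pchar K] by apply: (card_finPcharP hK).
have t2 : trace_sum n x ^+ 2 = trace_sum n x.
  rewrite /trace_sum -(pFrobenius_autE ch2) rmorph_sum /=.
  under eq_bigr => i _ do rewrite pFrobenius_autE -exprM -expnSr.
  case: n hK => [|k] hK; first by rewrite !big_ord0.
  by rewrite big_ord_recr big_ord_recl /= -hK expf_card expn0 expr1 addrC.
rewrite /absTr; case: eqVneq => [->|nz] //=.
by apply/(mulfI nz); rewrite mulr1 -expr2 t2.
Qed.

Definition walsh (K : finFieldType) (n : nat) (f : K -> 'F_2) (u : K) : int :=
  \sum_(x : K) (-1) ^+ (f x + absTr n (u * x))%R.

(* s may be any integer; the congruence makes the division by 2 exact. *)
Definition s_plateaued (K : finFieldType) (n : nat) (s : int) (f : K -> 'F_2)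
  : Prop :=
  (s = n%:Z %[mod 2])%Z /\
  forall u : K, ((walsh n f u)%:~R : rat) \in
    [:: 0; 2 ^ ((n%:Z + s) %/ 2)%Z; - 2 ^ ((n%:Z + s) %/ 2)%Z].

Definition plateaued (K : finFieldType) (n : nat) (f : K -> 'F_2) : Prop :=
  exists s : int, s_plateaued n s f.

(* For odd n the number 2 ^ (n / 2) is irrational, so no function is bent. *)
Definition bent (K : finFieldType) (n : nat) (f : K -> 'F_2) : bool :=
  ~~ odd n && [forall u : K, walsh n f u \in [:: 2 ^+ n./2; - 2 ^+ n./2]].

Definition component (K : finFieldType) (n : nat) (F : K -> K) (v : K)
  : K -> 'F_2 :=
  fun x => absTr n (v * F x).

Definition vplateaued (K : finFieldType) (n : nat) (F : K -> K) : Prop :=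
  forall v : K, v != 0 -> plateaued n (component n F v).

(* Bent components are counted by the index v, not as distinct functions. *)
Definition bent_components (K : finFieldType) (n : nat) (F : K -> K)
  : {set K} :=
  [set v : K | (v != 0) && bent n (component n F v)].

Definition nonlinearity (K : finFieldType) (n : nat) (F : K -> K) : rat :=
  2 ^+ (n - 1)%N -
  2^-1 * (\max_(uv : K * K | uv.2 != 0)
            `|walsh n (component n F uv.2) uv.1|%N)%:R.

(* Main.v *)
(* Write q = 2 ^ m.  The fourth moment of all Walsh coefficients counts the
   solutions of F x + F y + F z + F (x + y + z) = 0, hence is at least
   q ^ 4 (3 q ^ 4 - 2 q ^ 2).  By Parseval, a component with |W| <= b contributes
   at most b ^ 2 q ^ 4: q ^ 8 for v = 0 and q ^ 6 for a bent component.  If the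
   nonlinearity bound failed, then, since plateaued amplitudes are powers of 2,
   each of the q - 1 remaining components would have |W| ^ 2 <= q ^ 3 and
   contribute at most q ^ 7, for a total of at most 3 q ^ 8 - 2 q ^ 7, which is
   too small. *)

Require Import Defs.
From HB Require Import structures.
From mathcomp Require Import all_boot all_order all_algebra all_field.
From mathcomp Require Import ring zify.

Set Implicit Arguments.
Unset Strict Implicit.
Unset Printing Implicit Defensive.

Import Order.TTheory GRing.Theory Num.Theory.
Local Open Scope ring_scope.

(** * The canonical additive character of [K] *)

Definition achar (K : finFieldType) (n : nat) (x : K) : int :=
  (-1) ^+ (absTr n x).

Lemma signF2D (a b : 'F_2) :
  (-1) ^+ (a + b)%R = (-1) ^+ a * (-1) ^+ b :> int.
Proof. by case: a b => [[|[|?]] ?] [[|[|?]] ?]. Qed.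

Lemma pchar2 (K : finFieldType) (n : nat) : #|K| = (2 ^ n)%N -> 2 \in [pchar K].
Proof. by move=> hK; apply: (card_finPcharP hK). Qed.

Lemma trace_sumD (K : finFieldType) (n : nat) (x y : K) :
  2 \in [pchar K] -> trace_sum n (x + y) = trace_sum n x + trace_sum n y.
Proof.
move=> ch2; rewrite /trace_sum -big_split /=; apply: eq_bigr => i _.
by rewrite exprDn_pchar // pnatX (pnatE _ (pcharf_prime ch2)) ch2.
Qed.

(** Additivity of [trace_sum] in [K] passes to ['F_2] through [absTrE], since 0 and 1 are distinct
    in [K] and add there as in ['F_2]. *)
Lemma absTrD (K : finFieldType) (n : nat) (x y : K) :
  #|K| = (2 ^ n)%N -> absTr n (x + y) = absTr n x + absTr n y.
Proof.
move=> hK; have ch2 := pchar2 hK.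
have := trace_sumD n x y ch2; rewrite -!(absTrE _ hK).
have [f1 f2] : (1 : K) != 0 /\ (1 + 1 : K) = 0.
  by split; [exact: oner_neq0 | rewrite addrr_pchar2].
rewrite /absTr; do 3![case: ifP => _] => //= /eqP;
  rewrite ?add0r ?addr0 ?f2 ?modn_small ?[0 == 1]eq_sym ?(negPf f1) // => _;
  exact: val_inj.
Qed.

Lemma acharD (K : finFieldType) (n : nat) (x y : K) :
  #|K| = (2 ^ n)%N -> achar n (x + y) = achar n x * achar n y.
Proof. by move=> hK; rewrite /achar absTrD // signF2D. Qed.

Lemma achar0 (K : finFieldType) (n : nat) :
  #|K| = (2 ^ n)%N -> achar n (0 : K) = 1.
Proof.
move=> hK; have := acharD 0 0 hK; rewrite addr0 /achar /absTr.
by case: ifP.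
Qed.

(* The trace is a nonzero polynomial of degree 2 ^ (n - 1), so it cannot vanish
   on all 2 ^ n elements. *)
Lemma achar_nontrivial (K : finFieldType) (n : nat) :
  #|K| = (2 ^ n)%N -> exists x : K, achar n x = -1.
Proof.
case: n => [hK|n hK]; first by have := finRing_gt1 K; rewrite hK.
have [x nz|all0] := pickP (fun x : K => trace_sum n.+1 x != 0).
  by exists x; rewrite /achar /absTr (negPf nz).
pose p : {poly K} := \sum_(i < n.+1) 'X^(2 ^ i).
have szp : size p = (2 ^ n).+1.
  rewrite /p big_ord_recr /= addrC size_polyDl size_polyXn //.
  rewrite ltnS; apply: (leq_trans (size_sum _ _ _)).
  by apply/bigmax_leqP => i _; rewrite size_polyXn ltn_exp2l.
have nzp : p != 0 by rewrite -size_poly_eq0 szp.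
have /(max_poly_roots nzp)/(_ (enum_uniq K)) : all (root p) (enum K).
  apply/allP => x _; rewrite /root /p horner_sum.
  under eq_bigr do rewrite hornerXn.
  by apply: negbFE; exact: all0.
rewrite -cardE hK szp ltnS leq_exp2l // ltnn //.
Qed.

(** Orthogonality: for a nonzero [a], shifting [u] by [b / a] with [achar n b = -1] negates the
    sum. *)
Lemma achar_sum (K : finFieldType) (n : nat) (a : K) :
  #|K| = (2 ^ n)%N ->
  \sum_(u : K) achar n (u * a) = (a == 0)%:R * 2 ^+ n.
Proof.
move=> hK; case: eqVneq => [->|nza].
  under eq_bigr do rewrite mulr0 achar0 //.
  by rewrite sumr_const hK mul1r natrX.
rewrite mul0r; have [b hb] := achar_nontrivial hK.
set S := \sum_(u : K) _; suff : S = - S by lia.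
rewrite {1}/S (reindex_inj (addIr (b / a))) /= -sumrN.
apply: eq_bigr => u _; rewrite mulrDl divfK // acharD // hb mulrN1 //.
Qed.

(** * Second and fourth moments of Walsh coefficients *)

Lemma walshE (K : finFieldType) (n : nat) (f : K -> 'F_2) (u : K) :
  walsh n f u = \sum_(x : K) (-1) ^+ f x * achar n (u * x).
Proof. by apply: eq_bigr => x _; rewrite signF2D. Qed.

Lemma addf_eq0_pchar2 (K : fieldType) (x y : K) :
  2 \in [pchar K] -> (x + y == 0) = (x == y).
Proof. by move=> ch2; rewrite -{1}(oppr_pchar2 ch2 y) subr_eq0. Qed.

(** Parseval: after expanding the square, orthogonality in [u] keeps only the terms with [x = y]. *)
Lemma sum_walsh2 (K : finFieldType) (n : nat) (f : K -> 'F_2) :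
  #|K| = (2 ^ n)%N -> \sum_(u : K) walsh n f u ^+ 2 = 2 ^+ (2 * n).
Proof.
move=> hK; have ch2 := pchar2 hK.
transitivity (\sum_(x : K) \sum_(y : K)
    (-1) ^+ f x * (-1) ^+ f y * \sum_(u : K) achar n (u * (x + y))).
  under eq_bigr do rewrite walshE expr2 big_distrlr /=.
  rewrite exchange_big; apply: eq_bigr => x _ /=.
  rewrite exchange_big; apply: eq_bigr => y _ /=.
  rewrite mulr_sumr; apply: eq_bigr => u _.
  by rewrite mulrDr acharD // mulrACA.
transitivity (\sum_(x : K) (2 ^+ n : int)); last first.
  by rewrite sumr_const hK -[LHS]mulr_natr natrX -exprD addnn mul2n.
apply: eq_bigr => x _; rewrite (bigD1 x) //= [X in _ + X]big1 ?addr0 => [|y nyx].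
  by rewrite achar_sum // addrr_pchar2 // eqxx mul1r -expr2 sqrr_sign mul1r.
by rewrite achar_sum // addf_eq0_pchar2 // eq_sym (negPf nyx) mul0r mulr0.
Qed.

Lemma sum_expr4 (R : comRingType) (I : finType) (a : I -> R) :
  (\sum_x a x) ^+ 4 =
  \sum_x \sum_y \sum_z \sum_t a x * a y * a z * a t.
Proof.
transitivity ((\sum_x a x) * ((\sum_y a y) *
                ((\sum_z a z) * (\sum_t a t)))); first by ring.
rewrite mulr_suml; apply: eq_bigr => x _.
rewrite mulr_suml mulr_sumr; apply: eq_bigr => y _.
rewrite mulr_suml !mulr_sumr; apply: eq_bigr => z _.
by rewrite !mulr_sumr; apply: eq_bigr => t _; ring.
Qed.

(** Orthogonality in [u] keeps only the terms with [x + y + z + t = 0], that is [t = x + y + z] in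
    characteristic 2. *)
Lemma sum_walsh4 (K : finFieldType) (n : nat) (f : K -> 'F_2) :
  #|K| = (2 ^ n)%N ->
  \sum_(u : K) walsh n f u ^+ 4 =
  2 ^+ n * \sum_(x : K) \sum_(y : K) \sum_(z : K)
    (-1) ^+ f x * (-1) ^+ f y * (-1) ^+ f z * (-1) ^+ f (x + y + z).
Proof.
move=> hK; have ch2 := pchar2 hK.
transitivity (\sum_(x : K) \sum_(y : K) \sum_(z : K) \sum_(t : K)
    (-1) ^+ f x * (-1) ^+ f y * (-1) ^+ f z * (-1) ^+ f t
      * \sum_(u : K) achar n (u * (x + y + z + t))).
  under eq_bigr do rewrite walshE sum_expr4.
  rewrite exchange_big; apply: eq_bigr => x _ /=.
  rewrite exchange_big; apply: eq_bigr => y _ /=.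
  rewrite exchange_big; apply: eq_bigr => z _ /=.
  rewrite exchange_big; apply: eq_bigr => t _.
  rewrite mulr_sumr; apply: eq_bigr => u _.
  by rewrite !mulrDr !acharD //; ring.
rewrite mulr_sumr; apply: eq_bigr => x _.
rewrite mulr_sumr; apply: eq_bigr => y _.
rewrite mulr_sumr; apply: eq_bigr => z _.
rewrite (bigD1 (x + y + z)) //= [X in _ + X]big1 ?addr0 => [|t ntx].
  by rewrite achar_sum // addrr_pchar2 // eqxx mul1r mulrC.
by rewrite achar_sum // addf_eq0_pchar2 // eq_sym (negPf ntx) mul0r mulr0.
Qed.

Lemma walsh_le (K : finFieldType) (n : nat) (f : K -> 'F_2) (u : K) :
  #|K| = (2 ^ n)%N -> (`|walsh n f u| <= 2 ^ n)%N.
Proof.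
move=> hK; rewrite -(@leq_exp2r _ _ 2) // -lez_nat -abszX.
rewrite gez0_abs ?sqr_ge0 // -expnM -natz natrX mulnC -(sum_walsh2 f hK).
by rewrite (bigD1 u) //= lerDl sumr_ge0 // => v _; exact: sqr_ge0.
Qed.

(** Two of the four factors are bounded by [b]; Parseval sums the remaining square. *)
Lemma sum_walsh4_le (K : finFieldType) (n b : nat) (f : K -> 'F_2) :
  #|K| = (2 ^ n)%N -> (forall u, (`|walsh n f u| <= b)%N) ->
  \sum_(u : K) walsh n f u ^+ 4 <= b%:R ^+ 2 * 2 ^+ (2 * n).
Proof.
move=> hK hb; rewrite -(sum_walsh2 f hK) mulr_sumr; apply: ler_sum => u _.
rewrite natz (exprD _ 2 2) ler_wpM2r ?sqr_ge0 //.
by have := hb u; rewrite -[walsh n f u ^+ 2]real_normK ?num_real // !expr2; nia.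
Qed.

(* The summand is the indicator of x, y, z not being pairwise distinct, by
   inclusion-exclusion. *)
Lemma sum_coincidence (T : finType) (R : comRingType) (q : R) :
  #|T|%:R = q ->
  \sum_(x : T) \sum_(y : T) \sum_(z : T)
    ((x == y)%:R + (x == z)%:R + (y == z)%:R - 2 * ((x == y) && (y == z))%:R)
  = 3 * q ^+ 2 - 2 * q :> R.
Proof.
move=> hq.
have delta (x : T) : \sum_(y : T) (x == y)%:R = 1 :> R.
  by rewrite (bigD1 x) //= eqxx big1 ?addr0 // => y; rewrite eq_sym => /negPf->.
have cst (c : R) : \sum_(y : T) c = c * q.
  by rewrite sumr_const -[LHS]mulr_natr hq.
have inner x y : \sum_(z : T) ((x == y)%:R + (x == z)%:R + (y == z)%:R
    - 2 * ((x == y) && (y == z))%:R) = (x == y)%:R * (q - 2) + 2 :> R.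
  rewrite sumrB !big_split /= !delta cst -mulr_sumr.
  under [X in 2 * X]eq_bigr do rewrite -mulnb natrM.
  by rewrite -mulr_sumr delta; ring.
transitivity (\sum_(x : T) ((q - 2) + 2 * q)); last by rewrite cst; ring.
apply: eq_bigr => x _; under eq_bigr do rewrite inner.
by rewrite big_split /= -mulr_suml delta cst mul1r.
Qed.

(* Triples (x, y, z) with a repeated entry always satisfy
   F x + F y + F z + F (x + y + z) = 0; equality holds iff F is APN. *)
Lemma sum_component_walsh4_ge (K : finFieldType) (n : nat) (F : K -> K) :
  #|K| = (2 ^ n)%N ->
  2 ^+ (2 * n) * (3 * 2 ^+ (2 * n) - 2 * 2 ^+ n) <=
  \sum_(v : K) \sum_(u : K) walsh n (component n F v) u ^+ 4.
Proof.
move=> hK; have ch2 := pchar2 hK.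
under eq_bigr do rewrite sum_walsh4 //.
rewrite -mulr_sumr mul2n -addnn exprD -!mulrA ler_pM2l ?exprn_gt0 //.
rewrite exchange_big /=.
have hq : #|K|%:R = 2 ^+ n :> int by rewrite hK natrX.
have add3K (a b : K) : a + b + a = b by rewrite addrAC addrr_pchar2 // add0r.
have addKp (a b : K) : a + b + b = a by rewrite -addrA addrr_pchar2 // addr0.
rewrite -expr2 -(sum_coincidence hq) mulr_sumr; apply: ler_sum => x _.
rewrite [leRHS]exchange_big mulr_sumr /=; apply: ler_sum => y _.
rewrite [leRHS]exchange_big mulr_sumr /=; apply: ler_sum => z _.
(* The four signs multiply to the character at [v * (F x + F y + F z + F (x + y + z))], so the sum
   over [v] is [2 ^+ n] times the indicator of a solution. *)
under [leRHS]eq_bigr => v _ do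
  rewrite -!/(achar n _) -!acharD // -!mulrDr.
rewrite achar_sum // [leRHS]mulrC ler_wpM2l ?exprn_ge0 //.
have [->|nxy] := eqVneq x y.
  by rewrite !addrr_pchar2 // !add0r addrr_pchar2 // eqxx; case: (y == z).
have [xz|nxz] := eqVneq x z.
  by rewrite -xz !add3K addrr_pchar2 // eqxx eq_sym (negPf nxy).
have [->|nyz] := eqVneq y z; last by rewrite ler0n.
by rewrite !addKp [F x + F x]addrr_pchar2 // eqxx /= mulr0 subr0 !add0r.
Qed.

(** * Plateaued amplitudes and the final estimate *)

Lemma plateaued_walsh_pow2 (K : finFieldType) (n : nat) (f : K -> 'F_2)
  (u : K) :
  plateaued n f ->
  walsh n f u = 0 \/ exists j : nat, `|walsh n f u|%N = (2 ^ j)%N.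
Proof.
case=> s [_ /(_ u)]; set w := walsh n f u; set z := (_ %/ _)%Z => hw.
have [->|nzw] := eqVneq w 0; [by left | right].
have {hw} : (`|w|%N%:R : rat) = 2 ^ z.
  rewrite natr_absz intr_norm; move: hw; rewrite !inE intr_eq0 (negPf nzw) /=.
  by case/orP => /eqP->; rewrite ?normrN gtr0_norm ?exprz_gt0.
case: z => [j|j] hj; first by exists j; apply/eqP; rewrite -(eqr_nat rat) hj natrX.
(* The exponent [z] could be negative a priori, but then the positive integer [|w|] would be less
   than 1. *)
suff : (`|w|%N%:R : rat) < 1 by rewrite ltrn1 => /eqP; lia.
by rewrite hj NegzE -exprnN invf_lt1 ?exprn_gt0 // exprn_egt1.
Qed.

Theorem theorem1 (n m : nat) (K : finFieldType) (F : K -> K)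
  (hm : (1 <= m)%N)
  (hn : n = (2 * m)%N)
  (hK : #|K| = (2 ^ n)%N)
  (hplat : vplateaued n F)
  (hbent : #|bent_components n F| = (2 ^ n - 2 ^ m)%N) :
  nonlinearity n F <= 2 ^+ (n - 1)%N - 2 ^+ ((n + m) %/ 2)%N.
Proof.
rewrite /nonlinearity; set k := ((n + m) %/ 2)%N; set M := \max_(uv | _) _.
(* Clearing the factor 1/2 turns the claim into [2 ^ k.+1 <= M]; its negation is assumed. *)
rewrite lerD2l lerN2 -(ler_pM2l (ltr0n _ 2)) mulrA divff // mul1r.
rewrite -exprS -natrX ler_nat leqNgt; apply/negP => ltM.
pose B := bent_components n F; pose q : int := 2 ^+ m.
have q2 : 2 <= q by rewrite -[2]expr1 ler_eXn2l.
have qE j : 2 ^+ (j * m) = q ^+ j :> int by rewrite mulnC exprM.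
pose S v := \sum_(u : K) walsh n (component n F v) u ^+ 4.
have n4 : (2 * n = 4 * m)%N by rewrite hn mulnA.
have S0 : S 0 <= q ^+ 8.
  apply: le_trans (sum_walsh4_le hK (fun u => walsh_le _ u hK)) _.
  by rewrite natrX -exprM -exprD n4 hn -!qE ler_eXn2l //; lia.
have SB v : v \in B -> S v <= q ^+ 6.
  rewrite inE => /andP[_ /andP[_ /forallP hb]].
  apply: le_trans (sum_walsh4_le (b := 2 ^ m) hK _) _ => [u|].
    have := hb u; rewrite hn mul2n doubleK !inE.
    by case/orP => /eqP->; rewrite ?abszN abszX.
  by rewrite natrX -exprM -exprD n4 -!qE ler_eXn2l //; lia.
have SN v : v != 0 -> S v <= q ^+ 7.
  move=> nzv.
  apply: le_trans (sum_walsh4_le (b := 2 ^ k) hK _) _ => [u|].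
    have [->|[j hj]] := plateaued_walsh_pow2 u (hplat v nzv) => //.
    (* A power [2 ^ j] below [2 ^ k.+1] has [j <= k]. *)
    rewrite hj leq_exp2l // -ltnS -(@ltn_exp2l 2) // -hj.
    apply: leq_ltn_trans ltM.
    exact: (@leq_bigmax_cond _ _ _ (u, v)).
  (* As [k] is a floor, [2 * k <= n + m = 3 * m], hence [b ^ 2 <= q ^ 3]. *)
  rewrite natrX -exprM -exprD n4 -!qE ler_eXn2l // /k hn; lia.
have le_mn : (2 ^ m <= 2 ^ n)%N by rewrite leq_exp2l // hn; lia.
(* The complement of [B] contains the index 0, which leaves [2 ^ m - 1] nonzero indices outside
   [B]. *)
have cB : #|~: B| = (2 ^ m)%N by have := cardsC B; rewrite hbent hK; lia.
have B0 : 0 \in ~: B by rewrite !inE eqxx.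
have cBN : #|~: B :\ 0| = (2 ^ m - 1)%N.
  by have := cardsD1 0 (~: B); rewrite B0 cB => ->; rewrite add1n subn1.
have sumB : \sum_(v in B) S v <= q ^+ 6 * (q ^+ 2 - q).
  apply: le_trans (ler_sum _ SB) _; rewrite sumr_const hbent -[leLHS]mulr_natr.
  by rewrite natrB // !natrX hn qE.
have sumN : \sum_(v in ~: B :\ 0) S v <= q ^+ 7 * (q - 1).
  apply: (@le_trans _ _ (\sum_(v in ~: B :\ 0) q ^+ 7)).
    by apply: ler_sum => v; rewrite !inE => /andP[/SN].
  by rewrite sumr_const cBN -[leLHS]mulr_natr natrB ?expn_gt0 // natrX.
have : \sum_v S v <= q ^+ 6 * (q ^+ 2 - q) + (q ^+ 8 + q ^+ 7 * (q - 1)).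
  rewrite (bigID (mem B)) /= lerD //.
  rewrite (eq_bigl (mem (~: B))) => [|v]; last by rewrite !inE.
  by rewrite (big_setD1 0) //= lerD.
apply/negP; rewrite -ltNge.
apply: lt_le_trans (sum_component_walsh4_ge F hK).
rewrite n4 hn !qE -subr_gt0.
(* The lower bound [3 q^8 - 2 q^6] exceeds the upper bound [3 q^8 - 2 q^7] because [q >= 2]. *)
have -> : q ^+ 4 * (3 * q ^+ 4 - 2 * q ^+ 2)
    - (q ^+ 6 * (q ^+ 2 - q) + (q ^+ 8 + q ^+ 7 * (q - 1)))
  = 2 * q ^+ 6 * (q - 1) by ring.
by rewrite !mulr_gt0 ?exprn_gt0 ?subr_gt0 //; lia.
Qed.
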